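(* Let $k$ be a positive integer with $k\equiv 12\pmod{25}$. Then for all integers $n\geq 0$, $$\Delta_{k}(25n+24)\equiv 0\pmod{5}.$$
   Context: For a positive integer $k$, $\Delta_k(n)$ denotes the number of broken $k$-diamond partitions of $n$ (Andrews and Paule). The integers $\Delta_k(n)$, $n\ge 0$, are determined by the generating function $$\sum_{n=0}^{\infty}\Delta_{k}(n)q^{n}=\frac{(q^{2};q^{2})_{\infty}\,(q^{2k+1};q^{2k+1})_{\infty}}{(q;q)_{\infty}^{3}\,(q^{2(2k+1)};q^{2(2k+1)})_{\infty}},$$ where $|q|<1$ (or as formal power series in $q$) and $(a;q)_{\infty}:=\prod_{n=0}^{\infty}(1-aq^{n})$. This identity may be taken as the definition of $\Delta_k(n)$. *)

(* Defs.v *)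
From mathcomp Require Import all_boot all_order all_algebra.
From mathcomp Require Import zify.

Set Implicit Arguments.
Unset Strict Implicit.
Unset Printing Implicit Defensive.

Import GRing.Theory.
Local Open Scope ring_scope.

(* A formal power series in q over the integers, given by its coefficients. *)
Definition fps := nat -> int.

Definition fps1 : fps := fun n => (n == 0)%:R.

Definition fps_mul (f g : fps) : fps :=
  fun n => \sum_(i < n.+1) f i * g (n - i)%N.

Definition fps_exp (f : fps) (m : nat) : fps := iter m (fps_mul f) fps1.

(* The first n + 1 coefficients of 1 / f when f has constant term 1, the only
   case where the result is meaningful (see fps_mulfV). *)
Fixpoint fps_inv_seq (f : fps) (n : nat) : seq int :=
  if n is m.+1 then
    let s := fps_inv_seq f m in
    rcons s (- \sum_(i < m.+1) s`_i * f (m.+1 - i)%N)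
  else [:: 1].

Definition fps_inv (f : fps) : fps := fun n => (fps_inv_seq f n)`_n.

Definition fps_div (f g : fps) : fps := fps_mul f (fps_inv g).

(* (q^a; q^b)_oo = \prod_(i >= 0) (1 - q^(a + b i)), for a, b > 0: the factors
   with i > n are 1 modulo q^(n+1), so the coefficient of q^n is read off the
   product of the first n + 1 factors (see qpoch_stable). *)
Definition qpoch (a b : nat) : fps :=
  fun n => (\prod_(i < n.+1) (1 - 'X^(a + b * i)) : {poly int})`_n.

(* The number Delta_k(n) of broken k-diamond partitions of n. *)
Definition broken_diamond (k : nat) : fps :=
  fps_div
    (fps_mul (qpoch 2 2) (qpoch (2 * k + 1) (2 * k + 1)))
    (fps_mul (fps_exp (qpoch 1 1) 3)
             (qpoch (2 * (2 * k + 1)) (2 * (2 * k + 1)))).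

Lemma qpoch_stable (a b n N : nat) : (0 < a)%N -> (0 < b)%N -> (n < N)%N ->
  (\prod_(i < N) (1 - 'X^(a + b * i)) : {poly int})`_n = qpoch a b n.
Proof.
move=> a0 b0; rewrite /qpoch; elim: N => // N IH.
rewrite ltnS leq_eqVlt => /orP[/eqP -> //|ltnN].
rewrite big_ord_recr /= mulrBr mulr1 coefB coefMXn IH //.
by rewrite ifT ?subr0 //; nia.
Qed.

Lemma qpoch0 (a b : nat) : (0 < a)%N -> qpoch a b 0 = 1.
Proof.
move=> a0; rewrite /qpoch big_ord1 muln0 addn0 coefB coef1 coefXn.
by case: a a0 => // a _; rewrite subr0.
Qed.

Lemma fps_mul0 (f g : fps) : fps_mul f g 0 = f 0%N * g 0%N.
Proof. by rewrite /fps_mul big_ord1. Qed.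

Lemma fps_mulE (f g : fps) (n N : nat) : (n < N)%N ->
  fps_mul f g n = ((\poly_(i < N) f i) * (\poly_(i < N) g i))`_n.
Proof.
move=> ltnN; rewrite coefM; apply: eq_bigr => i _; rewrite !coef_poly.
by rewrite !ifT //; have := ltn_ord i; lia.
Qed.

Lemma fps_mul_eq (f f' g g' : fps) :
  f =1 f' -> g =1 g' -> fps_mul f g =1 fps_mul f' g'.
Proof. by move=> ff gg n; apply: eq_bigr => i _; rewrite ff gg. Qed.

Lemma fps_mulC (f g : fps) : fps_mul f g =1 fps_mul g f.
Proof. by move=> n; rewrite !(@fps_mulE _ _ n n.+1) // mulrC. Qed.

Lemma fps_mulA (f g h : fps) :
  fps_mul f (fps_mul g h) =1 fps_mul (fps_mul f g) h.
Proof.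
move=> n; pose P (u : fps) : {poly int} := \poly_(i < n.+1) u i.
have PE u i : (i <= n)%N -> (P u)`_i = u i by move=> ?; rewrite coef_poly ifT.
transitivity (P f * (P g * P h))`_n.
  rewrite coefM; apply: eq_bigr => i _; have := ltn_ord i => ?.
  by rewrite PE // (@fps_mulE _ _ _ n.+1) //; lia.
rewrite mulrA coefM; apply: eq_bigr => i _; have := ltn_ord i => ?.
by rewrite PE ?(@fps_mulE _ _ _ n.+1) //; lia.
Qed.

Lemma fps_mul1 (f : fps) : fps_mul fps1 f =1 f.
Proof.
move=> n; rewrite /fps_mul big_ord_recl /= mul1r subn0 big1 ?addr0 // => i _.
by rewrite /fps1 mul0r.
Qed.

Lemma size_fps_inv_seq (f : fps) (n : nat) : size (fps_inv_seq f n) = n.+1.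
Proof. by elim: n => //= n IH; rewrite size_rcons IH. Qed.

Lemma nth_fps_inv_seq (f : fps) (n i : nat) : (i <= n)%N ->
  (fps_inv_seq f n)`_i = fps_inv f i.
Proof.
elim: n => [|n IH]; first by rewrite leqn0 => /eqP ->.
rewrite leq_eqVlt => /orP[/eqP -> //|ltin].
by rewrite /= nth_rcons size_fps_inv_seq ltin IH.
Qed.

Lemma fps_mulfV (f : fps) : f 0%N = 1 -> fps_mul f (fps_inv f) =1 fps1.
Proof.
move=> f0 n; rewrite fps_mulC; case: n => [|n]; first by rewrite fps_mul0 f0.
rewrite /fps_mul big_ord_recr /= subnn f0 mulr1 {2}/fps_inv /=.
rewrite nth_rcons size_fps_inv_seq ltnn eqxx /fps1 /=.
apply/eqP; rewrite subr_eq0; apply/eqP/eq_bigr => i _.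
by rewrite nth_fps_inv_seq // -ltnS.
Qed.

Lemma fps_divP (f g h : fps) : g 0%N = 1 ->
  fps_mul g h =1 f <-> h =1 fps_div f g.
Proof.
move=> g0; split=> H n.
  rewrite /fps_div -(fps_mul_eq H (frefl _)) fps_mulC fps_mulA.
  have E := fps_mul_eq (fps_mulfV g0) (frefl h).
  by rewrite (fps_mul_eq (fps_mulC (fps_inv g) g) (frefl h)) E fps_mul1.
rewrite (fps_mul_eq (frefl g) H) /fps_div.
rewrite (fps_mul_eq (frefl g) (fps_mulC f (fps_inv g))) fps_mulA.
by rewrite (fps_mul_eq (fps_mulfV g0) (frefl f)) fps_mul1.
Qed.

(* The denominator has constant term 1, so the generating function identity
   holds for broken_diamond k and determines it. *)
Lemma broken_diamondP (k : nat) (D : fps) :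
  fps_mul (fps_mul (fps_exp (qpoch 1 1) 3)
                   (qpoch (2 * (2 * k + 1)) (2 * (2 * k + 1)))) D
    =1 fps_mul (qpoch 2 2) (qpoch (2 * k + 1) (2 * k + 1))
  <-> D =1 broken_diamond k.
Proof.
apply: fps_divP.
by rewrite /fps_exp /= !fps_mul0 /fps1 !qpoch0 // addn1 muln_gt0.
Qed.

(* Main.v *)
Require Import Defs.
From HB Require Import structures.
From mathcomp Require Import all_boot all_order all_algebra.
From mathcomp Require Import boolp zify ring finfield.

Set Implicit Arguments.
Unset Strict Implicit.
Unset Printing Implicit Defensive.

Import GRing.Theory.
Local Open Scope ring_scope.

(** Write E_a for the product (q^a; q^a)_oo. As 25 divides 2k + 1, the two
    factors of the generating function that depend on k are series in q^25;
    they do not mix the residue classes of exponents modulo 25, and the question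
    is about the coefficients of q^(25n+24) in E_2 / E_1^3 modulo 5.

    Over F_5 every series satisfies g(q^5) = g^5. Hence the operator U_r that
    sends the sum of f_n q^n to the sum of f_(5n+r) q^n is linear over fifth
    powers: U_r (g^5 f) = g U_r(f) ([dissect_frob]). The coefficients in question
    are those of U_4 (U_4 (E_2 / E_1^3)), and each U_4 is computed after pulling
    out fifth powers.

    First step. Let Theta be the sum of q^(d(d-1)/2) over all integers d. Gauss's
    identity Theta E_1 = 2 E_2^2 ([gauss]) makes E_2 / E_1^3 a constant multiple
    of Theta^3 / E_2^5. Triangular numbers are 0, 1 or 3 modulo 5, and those that
    are 3 are exactly 25 t + 3 with t triangular, so Theta = a^5 + b^5 q + c^5 q^3
    with c = Theta^5. The only monomials of Theta^3 with exponent 4 modulo 5 are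
    a b c (six times) and c^3, so that U_4 (Theta^3) = 6 a b c + c^3 q, which is
    c (a b + c^2 q) in characteristic 5. Finally a b + c^2 q = Theta^2
    ([theta_square]): Theta^2 counts pairs of odd integers X, Y by X^2 + Y^2, and
    multiplying X + iY by the Gaussian integer 2 + i, followed by an exchange of the
    coordinates for half of the pairs not divisible by 5, matches the pairs for n
    with those pairs for 5n + 1 whose first triangular number is 0 or 3 modulo 5;
    a b + c^2 q counts the latter. Altogether U_4 (Theta^3) = Theta^7
    ([dissect4_theta_cube]).

    Second step. It remains to apply U_4 to Theta^7 / E_2, which by Gauss's
    identity is a constant times a fifth power times E_1^3 E_2^3. Jacobi's identity
    expands E_a^3 as a sum of terms +-(2d - 1) q^(a d(d-1)/2); modulo 5 the terms
    with d(d-1)/2 congruent to 3 vanish, because 5 then divides 2d - 1. The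
    exponents left in E_1^3 are 0 or 1 modulo 5, those left in E_2^3 are 0 or 2,
    and no sum of these is 4 ([dissect4_euler_cubes]).

    The identities of Gauss and Jacobi are limits of polynomial identities
    ([finite_gauss], [finite_jacobi]), which are the value and the derivative at
    z = 1 of the q-binomial theorem centred at its middle factor. *)

(** * The ring of formal power series *)

Definition series (R : Type) : Type := nat -> R.

HB.instance Definition _ (R : Type) := gen_eqMixin (series R).
HB.instance Definition _ (R : Type) := gen_choiceMixin (series R).

Section SeriesRing.
Variable R : comNzRingType.
Implicit Types (f g h : series R) (p : {poly R}) (n N : nat).

Definition series0 : series R := fun=> 0.
Definition series1 : series R := fun n => (n == 0%N)%:R.
Definition series_opp f : series R := fun n => - f n.
Definition series_add f g : series R := fun n => f n + g n.
Definition series_mul f g : series R := fun n => \sum_(i < n.+1) f i * g (n - i)%N.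

Fact series_addA : associative series_add.
Proof. by move=> f g h; apply: funext => n; apply: addrA. Qed.
Fact series_addC : commutative series_add.
Proof. by move=> f g; apply: funext => n; apply: addrC. Qed.
Fact series_add0 : left_id series0 series_add.
Proof. by move=> f; apply: funext => n; apply: add0r. Qed.
Fact series_addN : left_inverse series0 series_opp series_add.
Proof. by move=> f; apply: funext => n; apply: addNr. Qed.

HB.instance Definition _ := GRing.isZmodule.Build (series R)
  series_addA series_addC series_add0 series_addN.

Fact series_mul_trunc f g n N : (n < N)%N ->
  series_mul f g n = ((\poly_(i < N) f i) * (\poly_(i < N) g i))`_n.
Proof.
move=> ltnN; rewrite coefM; apply: eq_bigr => i _; rewrite !coef_poly.
by rewrite !ifT //; have := ltn_ord i; lia.
Qed.

Fact series_mulC : commutative series_mul.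
Proof.
by move=> f g; apply: funext => n; rewrite !(series_mul_trunc _ _ (ltnSn n)) mulrC.
Qed.

Fact series_mulA : associative series_mul.
Proof.
move=> f g h; apply: funext => n; pose P u : {poly R} := \poly_(i < n.+1) u i.
have PE u i : (i <= n)%N -> (P u)`_i = u i by move=> ?; rewrite coef_poly ifT.
transitivity (P f * (P g * P h))`_n.
  rewrite coefM; apply: eq_bigr => i _; have := ltn_ord i => ?.
  by rewrite PE // (@series_mul_trunc _ _ _ n.+1) //; lia.
rewrite mulrA coefM; apply: eq_bigr => i _; have := ltn_ord i => ?.
by rewrite PE ?(@series_mul_trunc _ _ _ n.+1) //; lia.
Qed.

Fact series_mul1 : left_id series1 series_mul.
Proof.
move=> f; apply: funext => n; rewrite /series_mul big_ord_recl mul1r subn0.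
by rewrite big1 ?addr0 // => i _; rewrite /series1 mul0r.
Qed.

Fact series_mulDl : left_distributive series_mul series_add.
Proof.
move=> f g h; apply: funext => n; rewrite /series_mul /series_add -big_split.
by apply: eq_bigr => i _; apply: mulrDl.
Qed.

Fact series1_neq0 : series1 != 0.
Proof.
by apply/eqP => /(congr1 (fun f => f 0%N)) /eqP; rewrite /series1 eqxx oner_eq0.
Qed.

HB.instance Definition _ := GRing.Zmodule_isComNzRing.Build (series R)
  series_mulA series_mulC series_mul1 series_mulDl series1_neq0.

Lemma seriesD f g n : (f + g) n = f n + g n. Proof. by []. Qed.
Lemma seriesM f g n : (f * g) n = \sum_(i < n.+1) f i * g (n - i)%N.
Proof. by []. Qed.
Lemma seriesM0 f g : (f * g) 0%N = f 0%N * g 0%N.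
Proof. by rewrite seriesM big_ord1. Qed.

Lemma seriesX0 f m : (f ^+ m) 0%N = f 0%N ^+ m.
Proof. by elim: m => [|m IH] //; rewrite !exprS seriesM0 IH. Qed.

Lemma series_sum I (r : seq I) (P : pred I) (F : I -> series R) n :
  (\sum_(i <- r | P i) F i) n = \sum_(i <- r | P i) F i n.
Proof. by apply: (big_morph (fun f => f n)). Qed.

Definition pser p : series R := fun n => p`_n.

Fact pser_is_zmod_morphism : zmod_morphism pser.
Proof. by move=> p q; apply: funext => n; rewrite /pser coefB. Qed.
Fact pser_is_monoid_morphism : monoid_morphism pser.
Proof.
by split=> [|p q]; apply: funext => n; rewrite /pser ?coef1 ?coefM.
Qed.
HB.instance Definition _ :=
  GRing.isZmodMorphism.Build {poly R} (series R) pser pser_is_zmod_morphism.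
HB.instance Definition _ :=
  GRing.isMonoidMorphism.Build {poly R} (series R) pser pser_is_monoid_morphism.

Lemma pserXnM m f n :
  (pser 'X^m * f) n = if (n < m)%N then 0 else f (n - m)%N.
Proof.
rewrite seriesM; case: ltnP => [lt|le].
  rewrite big1 // => i _; rewrite /pser coefXn; case: eqP => [E|]; rewrite ?mul0r //.
  by have := ltn_ord i; lia.
have lt : (m < n.+1)%N by lia.
rewrite (bigD1 (Ordinal lt)) //= big1 ?addr0; last first.
  move=> i; rewrite -val_eqE /= => ne.
  by rewrite /pser coefXn (negbTE ne) mul0r.
by rewrite /pser coefXn eqxx mul1r.
Qed.

(** Equality modulo q^N: identities between infinite products and sums are
    obtained as limits of polynomial identities in this sense. *)
Definition eqm N f g := forall n, (n < N)%N -> f n = g n.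

Lemma eqm_sym N f g : eqm N f g -> eqm N g f.
Proof. by move=> E n /E. Qed.
Lemma eqm_trans N g f h : eqm N f g -> eqm N g h -> eqm N f h.
Proof. by move=> E1 E2 n lt; rewrite E1 ?E2. Qed.
Lemma eqm_le N M f g : (N <= M)%N -> eqm M f g -> eqm N f g.
Proof. by move=> le E n lt; apply: E; lia. Qed.

Lemma eqm_mul N f f' g g' : eqm N f f' -> eqm N g g' -> eqm N (f * g) (f' * g').
Proof.
move=> E1 E2 n lt; rewrite !seriesM; apply: eq_bigr => i _.
by rewrite E1 ?E2 //; have := ltn_ord i; lia.
Qed.

Lemma eqm_exp N f f' m : eqm N f f' -> eqm N (f ^+ m) (f' ^+ m).
Proof. by move=> E; elim: m => // m IH; rewrite !exprS; apply: eqm_mul. Qed.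

Lemma eqm_sum N (I : eqType) (r : seq I) (F G : I -> series R) :
  (forall i, i \in r -> eqm N (F i) (G i)) ->
  eqm N (\sum_(i <- r) F i) (\sum_(i <- r) G i).
Proof.
move=> E n lt; rewrite !series_sum !big_seq; apply: eq_bigr => i ri.
exact: E.
Qed.

Lemma eqm_Xn N m f g : eqm N f g -> eqm (m + N) (pser 'X^m * f) (pser 'X^m * g).
Proof. by move=> E n lt; rewrite !pserXnM; case: ltnP => // le; apply: E; lia. Qed.

(** A series with constant term 1 is a unit modulo q^N: the coefficient of q^n
    in f * g is g n plus terms in g 0, ..., g (n - 1). *)
Lemma eqm_cancel N f g h : f 0%N = 1 -> eqm N (f * g) (f * h) -> eqm N g h.
Proof.
move=> f0 E n; elim/ltn_ind: n => n IH ltN; have := E n ltN.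
rewrite !seriesM !big_ord_recl f0 !mul1r subn0 (eq_bigr (fun i : 'I_n =>
  f (lift ord0 i) * h (n - lift ord0 i)%N)) => [/addIr //|i _].
by congr (_ * _); apply: IH; have := ltn_ord i; rewrite lift0; lia.
Qed.

Lemma eqm_eq f g : (forall N, eqm N f g) -> f = g.
Proof. by move=> E; apply: funext => n; apply: (E n.+1). Qed.

Lemma series_cancel f g h : f 0%N = 1 -> f * g = f * h -> g = h.
Proof.
by move=> f0 E; apply: eqm_eq => N; apply: (eqm_cancel f0); rewrite E.
Qed.
End SeriesRing.

(** * The q-binomial theorem *)

Section QBinomial.
Variable R : comNzRingType.
Implicit Types (q y z : R).

(** This Pascal rule peels the first factor off the product in
    [qbinomial_theorem], which turns z into z * q. *)
Fixpoint qbin q (m j : nat) : R :=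
  match m, j with
  | _, 0 => 1
  | 0, _.+1 => 0
  | m'.+1, j'.+1 => q ^+ j * qbin q m' j + qbin q m' j'
  end.

Definition qfact q m : R := \prod_(i < m) (1 - q ^+ i.+1).

Lemma qbin0 q m : qbin q m 0 = 1. Proof. by case: m. Qed.
Lemma qbinS q m j :
  qbin q m.+1 j.+1 = q ^+ j.+1 * qbin q m j.+1 + qbin q m j.
Proof. by []. Qed.

Arguments qbin : simpl never.

Lemma qbin_small q m j : (m < j)%N -> qbin q m j = 0.
Proof.
elim: m j => [|m IH] [|j] //; rewrite ltnS => lt.
by rewrite qbinS !IH ?mulr0 ?addr0 //; lia.
Qed.

Lemma qfact0 q : qfact q 0 = 1. Proof. exact: big_ord0. Qed.
Lemma qfactS q m : qfact q m.+1 = qfact q m * (1 - q ^+ m.+1).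
Proof. exact: big_ord_recr. Qed.

Lemma qbin_fact q a b :
  qbin q (a + b) a * qfact q a * qfact q b = qfact q (a + b).
Proof.
have [n le] := ubnP (a + b); elim: n => // n IH in a b le *.
case: a b le => [|a] [|b] le; rewrite ?add0n ?qbin0 ?qfact0 ?mul1r //.
  rewrite addn0 mulr1.
  have -> : qbin q a.+1 a.+1 = 1; last by rewrite mul1r.
  by elim: (a.+1) => // c IHc; rewrite qbinS qbin_small // mulr0 add0r.
have E1 := IH a.+1 b; have E2 := IH a b.+1.
rewrite addSn addnS qbinS !qfactS exprS.
move: E1 E2; rewrite !addSn !addnS !qfactS => E1 E2.
transitivity (q ^+ a.+1 * (1 - q ^+ b.+1) *
    (qbin q (a + b).+1 a.+1 * (qfact q a * (1 - q ^+ a.+1)) * qfact q b) +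
  (1 - q ^+ a.+1) *
    (qbin q (a + b).+1 a * qfact q a * (qfact q b * (1 - q ^+ b.+1)))).
  by rewrite !exprS; ring.
rewrite E1 ?E2; [|lia..].
have -> : q ^+ (a + b).+2 = q ^+ a.+1 * q ^+ b.+1 by rewrite -exprD addSn addnS.
ring.
Qed.

(** The two-variable form stays polynomial when the product is centred by
    y = +- q^n, where the usual form would need z = q^(-n). *)
Theorem qbinomial_theorem q y z m :
  \prod_(i < m) (y + z * q ^+ i) =
  \sum_(j < m.+1) q ^+ 'C(j, 2) * qbin q m j * z ^+ j * y ^+ (m - j).
Proof.
elim: m z => [|m IH] z.
  by rewrite big_ord0 big_ord1 qbin0 !expr0 !mulr1.
rewrite big_ord_recl expr0 mulr1.
under eq_bigr => i _ do rewrite lift0 exprS mulrA.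
rewrite IH mulrDl !big_distrr [RHS]big_ord_recl /= !expr0 !mul1r subn0.
under [X in _ = _ + X]eq_bigr => j _ do
  rewrite -[bump 0 j]/(j.+1) qbinS subSS mulrDr !mulrDl.
rewrite big_split addrA; congr (_ + _); last first.
  apply: eq_bigr => j _.
  by rewrite binS bin1 exprD exprMn exprS; ring.
rewrite [in RHS]big_ord_recr qbin_small //= !(mulr0, mul0r) addr0.
rewrite [LHS]big_ord_recl /= qbin0 subn0 !expr0 !mul1r -exprS; congr (_ + _).
apply: eq_bigr => j _; have := ltn_ord j => lt.
by rewrite -[bump 0 j]/(j.+1) exprMn (_ : (m - j)%N = (m - j.+1).+1) ?[y ^+ _.+1]exprS; [ring|lia].
Qed.
End QBinomial.

(** * Finite forms of the identities of Gauss and Jacobi *)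

(** The triangular number d (d - 1) / 2 of an arbitrary integer. *)
Definition trig (d : int) : nat :=
  match d with Posz n => 'C(n, 2) | Negz n => 'C(n.+2, 2) end.

Lemma bin2Z (n : nat) : 'C(n, 2)%:Z * 2 = n%:Z * (n%:Z - 1).
Proof. by elim: n => // n IH; rewrite binS bin1; nia. Qed.

Lemma trigE d : (trig d)%:Z * 2 = d * (d - 1).
Proof. by case: d => n; rewrite /= bin2Z //; lia. Qed.

(** Recentring the exponents of the q-binomial theorem at j = n leaves a triangular
    number and a constant that can be cancelled. *)
Lemma trig_centre (n e j : nat) : (j <= n + n + e)%N ->
  ('C(j, 2) + n * (n + n + e - j) =
   trig (j%:Z - n%:Z) + ('C(n, 2) + n * (n + e)))%N.
Proof.
move=> le; have := trigE (j%:Z - n%:Z); have := bin2Z n; have := bin2Z j.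
have := subnKC le; set k := (_ - j)%N => /(congr1 (muln n)).
by rewrite !mulnDr; nia.
Qed.

Section FiniteIdentities.
Variables (R : idomainType) (q : R).
Hypothesis q0 : q != 0.

Lemma prod_powers n : \prod_(i < n) q ^+ i = q ^+ 'C(n, 2).
Proof.
elim: n => [|n IH]; first by rewrite big_ord0.
by rewrite big_ord_recr /= IH -exprD binS bin1 addnC.
Qed.

(** The factors before the central one, with their powers of q taken out; the
    product is reversed. *)
Lemma prod_below e n :
  \prod_(i < n) (q ^+ i + e * q ^+ n) =
  q ^+ 'C(n, 2) * \prod_(i < n) (1 + e * q ^+ i.+1).
Proof.
rewrite -prod_powers [X in _ = _ * X](reindex_inj rev_ord_inj) -big_split.
apply: eq_bigr => i _ /=; have := ltn_ord i => lt.
by rewrite mulrDr mulr1 mulrCA -exprD; congr (_ + _ * _ ^+ _); lia.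
Qed.

(** The factors from the central one on; [d] is the identity for Gauss, where
    the central factor is included, and the successor for Jacobi. *)
Lemma prod_above e n m (d : nat -> nat) :
  \prod_(i < n) (e * q ^+ m + q ^+ (m + d i)) =
  q ^+ (m * n) * \prod_(i < n) (e + q ^+ d i).
Proof.
elim: n => [|n IH]; first by rewrite !big_ord0 muln0 mulr1.
by rewrite !big_ord_recr /= IH mulnS !exprD; ring.
Qed.

(** The q-binomial theorem with z = 1 and y = q^n, divided by a power of q. *)
Theorem finite_gauss n :
  \sum_(j < (n + n).+1) q ^+ trig (j%:Z - n%:Z) * qbin q (n + n) j =
  (\prod_(i < n) (1 + q ^+ i.+1)) * \prod_(i < n) (1 + q ^+ i).
Proof.
have := qbinomial_theorem q (q ^+ n) 1 (n + n).
rewrite big_split_ord /=.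
have -> : \prod_(i < n) (q ^+ n + 1 * q ^+ i) =
          q ^+ 'C(n, 2) * \prod_(i < n) (1 + q ^+ i.+1).
  under eq_bigr do rewrite mul1r addrC -[q ^+ n]mul1r.
  by rewrite prod_below; under eq_bigr do rewrite mul1r.
have -> : \prod_(i < n) (q ^+ n + 1 * q ^+ (n + i)) =
          q ^+ (n * n) * \prod_(i < n) (1 + q ^+ i).
  by rewrite -(prod_above _ _ _ id); apply: eq_bigr => i _; rewrite !mul1r.
set P := \prod_(i < n) _; set Q := \prod_(i < n) _ => E.
have K0 : q ^+ ('C(n, 2) + n * n) != 0 by rewrite expf_neq0.
apply: (mulfI K0); transitivity (q ^+ 'C(n, 2) * P * (q ^+ (n * n) * Q)).
  rewrite E mulr_sumr; apply: eq_bigr => j _; have := ltn_ord j => lt.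
  have := @trig_centre n 0 j; rewrite !addn0 => C.
  rewrite expr1n mulr1 mulrAC -exprM -exprD C; last by lia.
  rewrite [q ^+ (trig _ + _)]exprD. ring.
by rewrite exprD; ring.
Qed.

(** With y = - q^n the middle factor of the product of 2n + 1 factors vanishes at
    z = 1, so the derivative there is, up to a power of q, the product of the
    others. As the value at z = 1 is 0, twice the derivative may be computed with
    the weights 2 j - (2 n + 1) = 2 d - 1, where d = j - n, instead of 2 j. *)
Theorem finite_jacobi n :
  \sum_(j < (n + n).+2) (-1) ^+ j.+1 * (2 * j%:R - (n + n).+1%:R) *
     (q ^+ trig (j%:Z - n%:Z) * qbin q (n + n).+1 j) =
  2 * (-1) ^+ n * qfact q n ^+ 2.
Proof.
pose y : {poly R} := (- q ^+ n)%:P; pose Q : {poly R} := q%:P.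
have qbinC m j : qbin Q m j = (qbin q m j)%:P.
  elim: m j => [|m IH] [|j]; rewrite ?qbin0 //.
  by rewrite !qbinS !IH polyCD polyCM rmorphXn.
pose c j := q ^+ 'C(j, 2) * qbin q (n + n).+1 j * (- q ^+ n) ^+ ((n + n).+1 - j).
have E := qbinomial_theorem Q y 'X (n + n).+1.
have {}E : \prod_(i < (n + n).+1) (y + 'X * Q ^+ i) =
           \sum_(j < (n + n).+2) c j *: 'X^j.
  rewrite E; apply: eq_bigr => j _.
  by rewrite qbinC -!rmorphXn -polyCM mulrAC -polyCM mul_polyC.
pose f i : {poly R} := y + 'X * Q ^+ i.
have fn : f n = (q ^+ n)%:P * ('X - 1).
  by rewrite /f /y /Q -rmorphXn polyCN; ring.
have f1 i : (f i).[1] = - q ^+ n + q ^+ i.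
  by rewrite /f -rmorphXn !hornerE.
pose P1 := \prod_(i < n) f i; pose P2 := \prod_(i < n) f (n.+1 + i)%N.
have {}E :
    ('X - 1) * ((q ^+ n)%:P * P1 * P2) = \sum_(j < (n + n).+2) c j *: 'X^j.
  rewrite -E -[in RHS]addnS big_split_ord big_ord_recl /= addn0.
  rewrite -/P1 -/(f n) fn (eq_bigr (fun i : 'I_n => f (n.+1 + i)%N)) => [|i _].
    by rewrite -/P2; ring.
  by rewrite /f /bump /= add1n addnS.
have at1 : \sum_(j < (n + n).+2) c j = 0.
  transitivity (\sum_(j < (n + n).+2) (c j *: 'X^j).[1]).
    by apply: eq_bigr => j _; rewrite hornerZ hornerXn expr1n mulr1.
  rewrite -horner_sum -E hornerM hornerD hornerN hornerX hornerC.
  by rewrite subrr mul0r.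
have P11 : P1.[1] = q ^+ 'C(n, 2) * qfact q n.
  rewrite horner_prod -[RHS](_ : \prod_(i < n) (q ^+ i + -1 * q ^+ n) = _).
    by apply: eq_bigr => i _; rewrite f1; ring.
  rewrite prod_below; congr (_ * _).
  by apply: eq_bigr => i _; rewrite mulN1r.
have P21 : P2.[1] = q ^+ (n * n) * ((-1) ^+ n * qfact q n).
  have -> : P2.[1] = \prod_(i < n) (-1 * q ^+ n + q ^+ (n + i.+1)).
    by rewrite horner_prod; apply: eq_bigr => i _; rewrite f1 addnS mulN1r.
  rewrite (prod_above _ _ _ S); congr (_ * _).
  rewrite (eq_bigr (fun i : 'I_n => - (1 - q ^+ i.+1))) => [|i _]; last by ring.
  by rewrite prodrN card_ord.
have deriv1 : \sum_(j < (n + n).+2) c j * j%:R =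
    q ^+ ('C(n, 2) + n * n.+1) * ((-1) ^+ n * qfact q n ^+ 2).
  transitivity (\sum_(j < (n + n).+2) (c j *: 'X^j)^`().[1]).
    apply: eq_bigr => j _.
    by rewrite derivZ derivXn hornerZ hornerMn hornerXn expr1n.
  rewrite -horner_sum -raddf_sum -E /= derivM derivB derivX derivC subr0 mul1r.
  rewrite hornerD !hornerM hornerD hornerN hornerX !hornerC subrr mul0r addr0.
  by rewrite P11 P21 mulnS !exprD; ring.
have K0 : q ^+ ('C(n, 2) + n * n.+1) != 0 by rewrite expf_neq0.
apply: (mulfI K0); transitivity
  (2 * \sum_(j < (n + n).+2) c j * j%:R -
   (n + n).+1%:R * \sum_(j < (n + n).+2) c j); last first.
  by rewrite at1 deriv1; ring.
rewrite !mulr_sumr -sumrB; apply: eq_bigr => j _; have := ltn_ord j => lt.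
have := @trig_centre n 1 j; rewrite !addn1 => C.
have -> : c j = (-1) ^+ j.+1 * qbin q (n + n).+1 j *
    q ^+ ('C(j, 2) + n * ((n + n).+1 - j)).
  have sgn : (-1) ^+ ((n + n).+1 - j) = (-1) ^+ j.+1 :> R.
    by rewrite -signr_odd -[RHS]signr_odd; congr (_ ^+ nat_of_bool _); lia.
  by rewrite /c [(- q ^+ n) ^+ _]exprNn sgn -exprM exprD; ring.
by rewrite C; [rewrite [q ^+ (trig _ + _)]exprD; ring | lia].
Qed.
End FiniteIdentities.

(** * Theta series *)

Definition window (M : nat) : seq int :=
  [seq j%:Z - M%:Z | j <- iota 0 (M + M).+1].

Arguments window : simpl never.

Lemma mem_window M d : (d \in window M) = ((- M%:Z <= d) && (d <= M%:Z))%R.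
Proof.
apply/mapP/idP => [[j]|lim]; first by rewrite mem_iota; lia.
by apply: (ex_intro2 _ _ (absz (d + M%:Z))); rewrite ?mem_iota; lia.
Qed.

Lemma uniq_window M : uniq (window M).
Proof. by rewrite map_inj_uniq ?iota_uniq // => i j; lia. Qed.

Lemma trig_window M d : (trig d < M)%N -> d \in window M.
Proof. by have := trigE d; rewrite mem_window; nia. Qed.

Section Theta.
Variable R : comNzRingType.

(** The sum of q^(trig d) over the integers d that satisfy P. The window that is
    searched contains every d with trig d = n, and so does any larger one
    ([thetaE]). *)
Definition theta (P : pred int) : series R :=
  fun n => (count [pred d | P d & trig d == n] (window n.+1))%:R.

Lemma thetaE P n M : (n < M)%N ->
  theta P n = (count [pred d | P d & trig d == n] (window M))%:R.
Proof.
move=> lt; congr (_%:R); rewrite -!size_filter; apply: perm_size.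
apply: uniq_perm; rewrite ?filter_uniq ?uniq_window // => d.
rewrite !mem_filter /=; apply: andb_id2l => /andP[_ /eqP E].
by rewrite !trig_window // E.
Qed.

Lemma natr_count (T : Type) (a : pred T) (s : seq T) :
  (count a s)%:R = \sum_(x <- s) (a x)%:R :> R.
Proof. by elim: s => [|x s IH]; rewrite ?big_nil ?big_cons //= natrD IH. Qed.

Lemma theta_trunc P M :
  eqm M (theta P) (\sum_(d <- window M | P d) pser 'X^(trig d)).
Proof.
move=> n lt; rewrite (thetaE _ lt) natr_count series_sum [RHS]big_mkcond.
by apply: eq_bigr => d _; rewrite /pser /= coefXn eq_sym; case: (P d).
Qed.

Lemma theta_mul P M n : (n < M)%N ->
  (theta P * theta predT) n =
  (count [pred de | P de.1 & trig de.1 + trig de.2 == n]%N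
     [seq (d, e) | d <- window M, e <- window M])%:R.
Proof.
move=> lt; rewrite (eqm_mul (@theta_trunc P M) (@theta_trunc predT M) lt).
rewrite natr_count big_allpairs big_distrl series_sum [LHS]big_mkcond /=.
apply: eq_bigr => d _; case: (P d) => /=; last by rewrite big1.
rewrite big_distrr series_sum; apply: eq_bigr => e _ /=.
by rewrite -rmorphM -exprD; rewrite /= /pser coefXn eq_sym.
Qed.
End Theta.

(** * Euler products *)

Section Euler.
Variable R : comNzRingType.

Definition reduce (f : fps) : series R := fun n => (f n)%:~R.

Lemma reduceM f g : reduce (fps_mul f g) = reduce f * reduce g.
Proof.
apply: funext => n; rewrite /reduce /fps_mul rmorph_sum.
by apply: eq_bigr => i _; rewrite rmorphM.
Qed.

Definition euler a : series R := reduce (qpoch a a).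

Lemma euler_trunc a M N : (0 < a)%N -> (N <= M)%N ->
  eqm N (euler a) (pser (qfact 'X^a M)).
Proof.
move=> a0 le n lt; rewrite /euler /reduce -(@qpoch_stable _ _ _ M) //; last lia.
have -> : qfact 'X^a M = map_poly (intr : int -> R) (\prod_(i < M) (1 - 'X^(a + a * i))).
  rewrite rmorph_prod; apply: eq_bigr => i _.
  by rewrite rmorphB rmorph1 /= map_polyXn -exprM mulnS.
by rewrite /pser coef_map.
Qed.

Lemma euler0 a : (0 < a)%N -> euler a 0%N = 1.
Proof. by move=> a0; rewrite /euler /reduce qpoch0. Qed.

(** The quotient of q-factorials that equals the q-binomial coefficient tends to
    E_a / E_a^2. *)
Lemma qbin_euler a N b c : (0 < a)%N -> (N <= b)%N -> (N <= c)%N ->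
  eqm N (pser (qbin 'X^a (b + c) b) * euler a) 1.
Proof.
move=> a0 leb lec; apply: (eqm_cancel (euler0 a0)); rewrite mulr1.
apply: eqm_trans (eqm_sym (euler_trunc a0 (leq_trans leb (leq_addr c b)))).
rewrite -qbin_fact !rmorphM mulrC -mulrA -mulrA.
by apply: eqm_mul => //; apply: eqm_mul; apply: euler_trunc.
Qed.
End Euler.

(** * The identities of Gauss and Jacobi *)

Section Limits.
Variable R : idomainType.

Lemma X_neq0 a : 'X^a != 0 :> {poly R}.
Proof. by rewrite monic_neq0 ?monicXn. Qed.

(** In [finite_gauss] the right-hand side tends to 2 (E_2 / E_1)^2 and each
    q-binomial coefficient to 1 / E_1. *)
Theorem gauss : theta R predT * euler R 1 = 2 * euler R 2 ^+ 2.
Proof.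
apply: eqm_eq => N; pose n := N.+1; pose q : {poly R} := 'X^1.
pose P m : {poly R} := \prod_(i < m) (1 + q ^+ i.+1).
have PE m : (N <= m)%N -> eqm N (pser (P m) * euler R 1) (euler R 2).
  move=> le; apply: (eqm_trans _ (eqm_sym (@euler_trunc R 2 m N isT le))).
  apply: (@eqm_trans _ _ (pser (P m) * pser (qfact q m))).
    by apply: eqm_mul => //; apply: euler_trunc.
  rewrite -rmorphM /P /qfact -big_split /=.
  rewrite (eq_bigr (fun i : 'I_m => 1 - 'X^2 ^+ i.+1)) // => i _.
  have -> : 'X^2 ^+ i.+1 = (q ^+ i.+1) ^+ 2 by rewrite /q expr1 -!exprM mulnC.
  by ring.
have th : eqm N (pser (P n * \prod_(i < n) (1 + q ^+ i)) * euler R 1)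
                (theta R predT).
  rewrite -finite_gauss ?X_neq0 // rmorph_sum mulr_suml.
  apply: (eqm_trans _ (eqm_le (leqnSn N) (eqm_sym (@theta_trunc R predT n)))).
  rewrite big_map -val_enum_ord big_map big_enum.
  apply: eqm_sum => j _; have := ltn_ord j => lt; set d := (_ - _).
  pose m := minn j (n + n - j).
  rewrite rmorphM -mulrA /q -exprM mul1n -[X in eqm _ _ X]mulr1.
  (* The q-binomial coefficient is known only modulo q^m, and m is small for
     large d; the factor q^(trig d) makes up for it, up to one unit, whence
     n = N + 1. *)
  apply: (@eqm_le _ _ (trig d + m)).
    have := trigE d; rewrite /d /m; nia.
  apply: eqm_Xn; have := @qbin_euler R 1 m j (n + n - j).
  by rewrite subnKC //; apply; rewrite /m; lia.
have PN := PE N (leqnn N); have Pn := PE n (leqnSn N).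
apply: (@eqm_trans _ _ (2 * (pser (P n) * euler R 1) * (pser (P N) * euler R 1))).
  apply: (@eqm_trans _ _ (pser (P n * \prod_(i < n) (1 + q ^+ i)) * euler R 1 * euler R 1)).
    by apply: eqm_mul => //; apply: eqm_sym.
  rewrite [\prod_(i < n) _]big_ord_recl expr0 -/(P N) !rmorphM rmorphD rmorph1.
  by rewrite (_ : _ * _ = 2 * (pser (P n) * euler R 1) * (pser (P N) * euler R 1)); [|ring].
by rewrite expr2 [X in eqm _ _ X]mulrA; apply: eqm_mul => //; apply: eqm_mul.
Qed.

(** By Jacobi's identity 2 E_a^3 is the sum of +-(2 d - 1) q^(a trig d) over all
    integers d, so a coefficient vanishes as soon as all weights 2 d - 1 that
    contribute to it do. *)
Lemma jacobi_support a N : (0 < a)%N ->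
  (forall d, (a * trig d)%N = N -> (2 * d - 1)%:~R = 0 :> R) ->
  (2 * euler R a ^+ 3) N = 0.
Proof.
move=> a0 H; pose n := N.+1; pose q : {poly R} := 'X^a.
pose w j : {poly R} := (-1) ^+ j.+1 * (2 * j%:R - (n + n).+1%:R).
have E : eqm n (pser (2 * (-1) ^+ n * qfact q n ^+ 2) * euler R a)
    (\sum_(j < (n + n).+2) pser (w j * q ^+ trig (j%:Z - n%:Z))).
  rewrite -finite_jacobi ?X_neq0 // rmorph_sum mulr_suml.
  apply: eqm_sum => j _; have := ltn_ord j => lt; pose d : int := j%:Z - n%:Z.
  pose m := minn j ((n + n).+1 - j).
  rewrite /w !rmorphM -!mulrA.
  apply: eqm_mul => //; apply: eqm_mul => //; rewrite /q -exprM -[X in eqm _ _ X]mulr1.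
  apply: (@eqm_le _ _ (a * trig d + m)).
    have : (trig d <= a * trig d)%N by rewrite leq_pmull.
    have := trigE d; rewrite /d /m; nia.
  apply: eqm_Xn; have := @qbin_euler R a m j ((n + n).+1 - j).
  by rewrite subnKC //; apply; rewrite /m; lia.
have {}E : eqm n (pser ((-1) ^+ n) * (2 * euler R a ^+ 3))
    (\sum_(j < (n + n).+2) pser (w j * q ^+ trig (j%:Z - n%:Z))).
  apply: (eqm_trans _ E).
  rewrite (_ : _ * _ = 2 * pser ((-1) ^+ n) * euler R a ^+ 2 * euler R a); last by ring.
  rewrite !rmorphM !rmorphXn; apply: eqm_mul => //; apply: eqm_mul.
    by rewrite rmorph_nat.
  by apply: eqm_exp; apply: euler_trunc.
have := E N (ltnSn N); rewrite series_sum [RHS]big1 => [|j _].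
  rewrite rmorphXn rmorphN1 -signr_odd; case: (odd n); last by rewrite mul1r.
  by rewrite mulN1r => /eqP; rewrite oppr_eq0 => /eqP.
pose d : int := j%:Z - n%:Z.
have -> : w j = ((-1) ^+ j.+1 * (2 * d - 1)%:~R)%:P.
  rewrite polyCM rmorphXn rmorphN1 /w /d; congr (_ * _).
  have -> : 2 * (j%:Z - n%:Z) - 1 = (2 * j)%:Z - (n + n).+1%:Z by lia.
  by rewrite rmorphB /= -!pmulrn polyCB !polyC_natr natrM.
rewrite /pser coefCM -exprM coefXn; case: eqP => [NE|]; last by rewrite mulr0.
by rewrite H ?mulr0 ?mul0r.
Qed.
End Limits.

(** * Sums of two triangular numbers *)

Lemma trig_mod5 d : (trig d %% 5)%N =
  if (d %% 5)%Z \in [:: 2; 4] then 1%N else if (d %% 5)%Z == 3 then 3%N else 0%N.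
Proof.
have := trigE d; have := divz_eq d 5; have := modz_ge0 d (isT : 5 != 0 :> int).
have := ltz_pmod d (isT : 0 < 5 :> int); rewrite !inE.
set w := (d %/ 5)%Z; set s := (d %% 5)%Z => s5 s0 ->.
have : s = 0 \/ s = 1 \/ s = 2 \/ s = 3 \/ s = 4 by lia.
by case=> [|[|[|[]]]] -> /=; lia.
Qed.

Definition trig_ne1 (d : int) : bool := (trig d %% 5 != 1)%N.

(** With X = 2 d - 1 and Y = 2 e - 1, the pair (x, y) below corresponds to the
    Gaussian integer (2 + i)(X + iY). These products are the pairs with
    x = 2 y + 2 modulo 5; when x has triangular number 1 modulo 5, exchanging the
    coordinates gives a pair satisfying y = 2 x + 2 instead. In this way all
    pairs (x, y) with trig x + trig y = 1 and trig x <> 1 modulo 5 are reached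
    exactly once. *)
Definition turn (de : int * int) : int * int :=
  let: (d, e) := de in
  let x := 2 * d - e in let y := d + 2 * e - 1 in
  if trig_ne1 x then (x, y) else (y, x).

Arguments turn : simpl never.

Lemma turn_trig de :
  (trig (turn de).1 + trig (turn de).2 = 5 * (trig de.1 + trig de.2) + 1)%N.
Proof.
case: de => d e; rewrite /turn /=; have := trigE d; have := trigE e.
have := trigE (2 * d - e); have := trigE (d + 2 * e - 1).
by case: ifP => _ /=; nia.
Qed.

Lemma trig_ne1_turn de : trig_ne1 (turn de).1.
Proof.
have := turn_trig de; case: de => d e; rewrite /turn; case: ifP => //= + E.
by rewrite /trig_ne1; lia.
Qed.

Lemma trig_ne1E d : trig_ne1 d = ((d %% 5)%Z != 2) && ((d %% 5)%Z != 4).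
Proof. by rewrite /trig_ne1 trig_mod5 !inE; case: (_ == 2); case: (_ == 4); case: (_ == 3). Qed.

(** The two branches cannot collide: a pair satisfying both congruences has
    x = y = 3 modulo 5, and is only produced without exchange. *)
Lemma turn_inj : injective turn.
Proof.
move=> [d e] [d' e']; rewrite /turn !trig_ne1E.
by do 2![case: ifP => ?] => -[? ?]; congr (_, _); lia.
Qed.

(** The residues of (trig x, trig y) are (0, 1) or (3, 3); the congruence that
    holds decides the branch, and division by 2 + i gives the preimage. *)
Lemma turn_onto x y n : trig_ne1 x -> (trig x + trig y = 5 * n + 1)%N ->
  exists de, turn de = (x, y).
Proof.
move=> Px E.
have [tied|[tied Py]] : (x = 2 * y + 2 %[mod 5])%Z \/
    (y = 2 * x + 2 %[mod 5])%Z /\ ~~ trig_ne1 y.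
- move: Px E (trig_mod5 x) (trig_mod5 y); rewrite !trig_ne1E !inE => Px E.
  do 4?[case: ifP => ?]; try lia.
  have [?|[?|[?|?]]] : (x %% 5 = 0 /\ y %% 5 = 2 \/ x %% 5 = 0 /\ y %% 5 = 4 \/
    x %% 5 = 1 /\ y %% 5 = 2 \/ x %% 5 = 1 /\ y %% 5 = 4)%Z by lia.
  + by right; split; [lia | lia].
  + by left; lia.
  + by left; lia.
  by right; split; [lia | lia].
- exists ((2 * x + y + 1) %/ 5, (2 * y - x + 2) %/ 5)%Z; rewrite /turn.
  have -> : 2 * ((2 * x + y + 1) %/ 5)%Z - ((2 * y - x + 2) %/ 5)%Z = x by lia.
  by rewrite Px; congr (_, _); lia.
exists ((2 * y + x + 1) %/ 5, (2 * x - y + 2) %/ 5)%Z; rewrite /turn.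
have -> : 2 * ((2 * y + x + 1) %/ 5)%Z - ((2 * x - y + 2) %/ 5)%Z = y by lia.
by rewrite (negbTE Py); congr (_, _); lia.
Qed.

(** * Series over F_5 and their residue classes of exponents *)

Local Notation F := 'F_5.
Local Notation q := (pser 'X : series F).
Implicit Types f g h : series F.

(** The operator U_r of the introduction. *)
Definition dissect r f : series F := fun n => f (5 * n + r)%N.

Lemma dissect_is_zmod_morphism r : zmod_morphism (dissect r).
Proof. by move=> f g; apply: funext. Qed.
HB.instance Definition _ r := GRing.isZmodMorphism.Build (series F) (series F)
  (dissect r) (dissect_is_zmod_morphism r).

Lemma dissectD r f g : dissect r (f + g) = dissect r f + dissect r g.
Proof. exact: raddfD. Qed.

Lemma dissectMn r f m : dissect r (f *+ m) = dissect r f *+ m.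
Proof. exact: raddfMn. Qed.

Lemma dissect_ext f g : (forall r, (r < 5)%N -> dissect r f = dissect r g) -> f = g.
Proof.
move=> E; apply: funext => n.
have := congr1 (fun h => h (n %/ 5)%N) (E _ (ltn_pmod n (isT : 0 < 5)%N)).
by rewrite /dissect mulnC -divn_eq.
Qed.

Lemma pchar_F : 5 \in [pchar F]. Proof. exact: pchar_Fp. Qed.

Lemma pchar_polyF : 5 \in [pchar {poly F}].
Proof. exact: (rmorph_pchar (polyC : {rmorphism F -> {poly F}}) pchar_F). Qed.

Lemma pchar_seriesF : 5 \in [pchar (series F)].
Proof. by rewrite inE /= -(rmorph_nat (@pser F)) (pcharf0 pchar_polyF) rmorph0. Qed.

Definition shift f : series F := fun n => f n.+1.

Lemma series_head_tail f :
  f = pser (f 0%N)%:P + q * shift f.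
Proof.
apply: funext => -[|n]; rewrite seriesD -['X]expr1 pserXnM /pser coefC /=.
  by rewrite addr0.
by rewrite add0r subn1.
Qed.

Lemma dissect_const c r f : dissect r (pser c%:P * f) = pser c%:P * dissect r f.
Proof.
have E g n : (pser c%:P * g) n = c * g n.
  rewrite seriesM big_ord_recl subn0 big1 ?addr0 => [|i _]; last first.
    by rewrite /pser coefC mul0r.
  by rewrite /pser coefC.
by apply: funext => n; rewrite /dissect !E.
Qed.

Lemma dissect_Xn s r : (r < 5)%N ->
  dissect r (q ^+ s) = if (s %% 5 == r)%N then q ^+ (s %/ 5) else 0.
Proof.
move=> lt; apply: funext => n.
have E m k : (q ^+ m) k = (k == m)%:R by rewrite -rmorphXn /= /pser coefXn.
rewrite /dissect E; case: (eqVneq (s %% 5)%N r) => C; rewrite ?E.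
  by rewrite (_ : (5 * n + r == s)%N = (n == s %/ 5)%N) //; lia.
by rewrite (_ : _ == _ = false) //; lia.
Qed.

Lemma expF5 (c : F) : c ^+ 5 = c.
Proof. by have := expf_card c; rewrite card_Fp. Qed.

(** Writing g = g_0 + q h gives g^5 = g_0 + q^5 h^5 in characteristic 5, and the
    statement for g follows from that for h one coefficient lower. *)
Lemma dissect_frob r g f : (r < 5)%N ->
  dissect r (g ^+ 5 * f) = g * dissect r f.
Proof.
move=> lt; apply: funext => n; elim/ltn_ind: n g => n IH g.
set h := shift g.
have frob : g ^+ 5 = pser (g 0%N)%:P + q ^+ 5 * h ^+ 5.
  rewrite {1}[g]series_head_tail -/h exprDn_pchar; last first.
    by rewrite pnatE // pchar_seriesF.
  by rewrite exprMn -!rmorphXn /= expF5.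
rewrite frob [in RHS](series_head_tail g) !mulrDl dissectD dissect_const !seriesD.
congr (_ + _); rewrite -[q ^+ 5 * _ * f]mulrA -[q * _ * _]mulrA.
rewrite -[q ^+ 5]rmorphXn -[q in RHS]expr1 -[q ^+ 1]rmorphXn pserXnM /dissect pserXnM.
case: n IH => [|n] IH /=; first by rewrite ifT //; lia.
rewrite ifF; last by lia.
have := IH n (ltnSn n) h; rewrite /dissect subn1 /= => <-.
by congr (_ _); lia.
Qed.

(** [turn] maps the solutions of trig d + trig e = n onto those of
    trig x + trig y = 5 n + 1 with trig x <> 1 modulo 5. *)
Lemma theta_square :
  theta F predT ^+ 2 = dissect 1 (theta F trig_ne1 * theta F predT).
Proof.
apply: funext => n; rewrite expr2 /dissect.
rewrite !(@theta_mul _ _ (5 * n + 2)); [|lia..].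
congr (_%:R); rewrite -!size_filter -(size_map turn); apply: perm_size.
set L := [seq (d, e) | d <- window _, e <- window _].
have mL x y : (trig x + trig y < 5 * n + 2)%N -> (x, y) \in L.
  by move=> lt; apply: allpairs_f; apply: trig_window; lia.
have uL : uniq L by rewrite allpairs_uniq ?uniq_window // => -[? ?] [? ?].
clearbody L.
apply: uniq_perm => [||[x y]]; rewrite ?filter_uniq ?(map_inj_uniq turn_inj) ?filter_uniq //.
rewrite mem_filter /= -andbA; apply/mapP/and3P => [[[d e]]|[Px /eqP E _]].
  rewrite mem_filter /= => /andP[/eqP E _] Et.
  have := turn_trig (d, e); have := trig_ne1_turn (d, e); rewrite -Et /= E => -> S.
  by split=> //; [apply/eqP | apply: mL; lia].
have [[d e] Et] := turn_onto Px E; exists (d, e) => //.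
have := turn_trig (d, e); rewrite Et /= E => S.
by rewrite mem_filter /= mL ?andbT; [apply/eqP; lia | lia].
Qed.

Lemma dissect_mono r g s : (r < 5)%N ->
  dissect r (g ^+ 5 * q ^+ s) =
  if (s %% 5 == r)%N then g * q ^+ (s %/ 5) else 0.
Proof.
move=> lt; rewrite dissect_frob // dissect_Xn //.
by case: ifP => // _; rewrite mulr0.
Qed.

(** * The class 4 modulo 5 of the cube of the theta series *)

Lemma dissect4_cube a b c :
  dissect 4 ((a ^+ 5 + b ^+ 5 * q + c ^+ 5 * q ^+ 3) ^+ 3) =
  6 * (a * b * c) + c ^+ 3 * q.
Proof.
pose m g s := g ^+ 5 * q ^+ s.
have -> : (a ^+ 5 + b ^+ 5 * q + c ^+ 5 * q ^+ 3) ^+ 3 =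
  m (a ^+ 3) 0 + m (a ^+ 2 * b) 1 *+ 3 + m (a * b ^+ 2) 2 *+ 3
  + m (b ^+ 3) 3 + m (a ^+ 2 * c) 3 *+ 3 + m (a * b * c) 4 *+ 6
  + m (b ^+ 2 * c) 5 *+ 3 + m (a * c ^+ 2) 6 *+ 3 + m (b * c ^+ 2) 7 *+ 3
  + m (c ^+ 3) 9.
  by rewrite /m; ring.
by rewrite !dissectD !dissect_mono //=; ring.
Qed.

Lemma dissect1_product a b c :
  dissect 1 ((a ^+ 5 + c ^+ 5 * q ^+ 3) *
             (a ^+ 5 + b ^+ 5 * q + c ^+ 5 * q ^+ 3)) =
  a * b + c ^+ 2 * q.
Proof.
pose m g s := g ^+ 5 * q ^+ s.
have -> : (a ^+ 5 + c ^+ 5 * q ^+ 3) *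
          (a ^+ 5 + b ^+ 5 * q + c ^+ 5 * q ^+ 3) =
  m (a ^+ 2) 0 + m (a * b) 1 + m (a * c) 3 *+ 2 + m (b * c) 4 + m (c ^+ 2) 6.
  by rewrite /m; ring.
by rewrite !dissectD !dissect_mono //=; ring.
Qed.

Lemma theta_eq (R : comNzRingType) (P Q : pred int) n :
  (forall d, trig d = n -> P d = Q d) -> theta R P n = theta R Q n.
Proof.
move=> E; congr (_%:R); apply: eq_count => d /=.
by case: eqP => [/E ->|_]; rewrite ?andbF.
Qed.

Lemma theta_eq0 (R : comNzRingType) (P : pred int) n :
  (forall d, trig d = n -> ~~ P d) -> theta R P n = 0.
Proof.
move=> E; rewrite (@theta_eq _ _ pred0) => [|d /E /negbTE //].
by rewrite /theta (@eq_count _ _ pred0) ?count_pred0.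
Qed.

Local Notation Theta := (theta F predT).

Lemma trig_residue d n r : trig d = (5 * n + r)%N -> (r < 5)%N -> r \in [:: 0; 1; 3]%N.
Proof.
move=> E lt; have := trig_mod5 d; rewrite E !inE.
by do 2?[case: ifP => ?]; lia.
Qed.

Lemma trig_stretch e : trig (5 * e - 2) = (25 * trig e + 3)%N.
Proof. by have := trigE (5 * e - 2); have := trigE e; nia. Qed.

Lemma trig_mod5_3 d n : trig d = (5 * n + 3)%N -> exists e, d = 5 * e - 2.
Proof.
move=> E; have := trig_mod5 d; rewrite E !inE => D.
exists ((d + 2) %/ 5)%Z; move: D.
by do 2?[case: ifP => ?]; lia.
Qed.

(** The triangular numbers that are 3 modulo 5 are 25 t + 3, where t runs over
    the triangular numbers with the same multiplicities. *)
Lemma dissect3_theta : dissect 3 Theta = Theta ^+ 5.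
Proof.
rewrite -[RHS]mulr1 -(expr0 q); apply: dissect_ext => r lt.
rewrite dissect_mono //; apply: funext => n; rewrite /dissect.
have [r0|r0] := eqVneq (0 %% 5)%N r; last first.
  apply: theta_eq0 => d /[dup] E /trig_mod5_3 [e De].
  by move: E; rewrite De trig_stretch; rewrite mod0n in r0; lia.
rewrite -r0 expr0 mulr1; congr (_%:R); rewrite -!size_filter.
move: (window (5 * (5 * n + 0) + 3).+1) (window n.+1) (uniq_window (5 * (5 * n + 0) + 3).+1)
  (uniq_window n.+1) (@trig_window (5 * (5 * n + 0) + 3).+1) (@trig_window n.+1).
move=> V W uV uW inV inW; rewrite -(size_map (fun e => 5 * e - 2) (filter _ W)).
apply: perm_size; apply: uniq_perm => [||d]; rewrite ?filter_uniq //.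
  by rewrite map_inj_uniq ?filter_uniq // => x y; lia.
rewrite mem_filter; apply/idP/mapP => [/andP[/= /eqP E _]|[e]].
  have [e De] := trig_mod5_3 E; exists e => //.
  have Te : trig e = n by move: E; rewrite De trig_stretch; lia.
  by rewrite mem_filter /= Te eqxx inW ?Te.
rewrite mem_filter /= => /andP[/eqP E _] ->.
by rewrite inV trig_stretch E ?andbT; [apply/eqP|]; lia.
Qed.

Lemma dissect_trinomial a b c r : (r < 5)%N ->
  dissect r (a ^+ 5 + b ^+ 5 * q + c ^+ 5 * q ^+ 3) = nth 0 [:: a; b; 0; c] r.
Proof.
move=> lt; transitivity
  (dissect r (a ^+ 5 * q ^+ 0 + b ^+ 5 * q ^+ 1 + c ^+ 5 * q ^+ 3)).
  by rewrite expr0 mulr1 expr1.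
rewrite !dissectD !dissect_mono //.
by case: r lt => [|[|[|[|[|//]]]]] _ /=; rewrite ?addr0 ?add0r ?mulr1.
Qed.

Lemma theta_dissection : Theta =
  dissect 0 Theta ^+ 5 + dissect 1 Theta ^+ 5 * q + Theta ^+ 5 ^+ 5 * q ^+ 3.
Proof.
rewrite -dissect3_theta; apply: dissect_ext => r lt.
rewrite dissect_trinomial //.
have off s : s \notin [:: 0; 1; 3]%N -> (s < 5)%N -> dissect s Theta = 0.
  move=> so s5; apply: funext => n; apply: theta_eq0 => d E.
  by case/negP: so; apply: trig_residue E s5.
by case: r lt => [|[|[|[|[|//]]]]] _ //=; rewrite off.
Qed.

Lemma theta_trig_ne1_dissection : theta F trig_ne1 =
  dissect 0 Theta ^+ 5 + Theta ^+ 5 ^+ 5 * q ^+ 3.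
Proof.
transitivity (dissect 0 Theta ^+ 5 + 0 ^+ 5 * q + Theta ^+ 5 ^+ 5 * q ^+ 3).
  apply: dissect_ext => r lt; rewrite dissect_trinomial //.
  have -> : dissect r (theta F trig_ne1) = if (r == 1)%N then 0 else dissect r Theta.
    apply: funext => n; rewrite /dissect; case: eqP => [->|r1].
      by apply: theta_eq0 => d E; rewrite /trig_ne1 E; lia.
    by apply: theta_eq => d E; rewrite /trig_ne1 E /=; lia.
  rewrite {1}theta_dissection dissect_trinomial //.
  by case: r lt => [|[|[|[|[|//]]]]].
by rewrite expr0n mul0r addr0.
Qed.

(** Here 6 a b c + c^3 q = c (a b + c^2 q) because 5 = 0, and the bracket is
    Theta^2. *)
Theorem dissect4_theta_cube : dissect 4 (Theta ^+ 3) = Theta ^+ 7.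
Proof.
set a := dissect 0 Theta; set b := dissect 1 Theta; set c := Theta ^+ 5.
have square : Theta ^+ 2 = a * b + c ^+ 2 * q.
  rewrite theta_square [X in _ * X]theta_dissection theta_trig_ne1_dissection.
  exact: dissect1_product.
have five : 5 = 0 :> series F by apply: (pcharf0 pchar_seriesF).
rewrite {1}theta_dissection dissect4_cube -/a -/b -/c.
transitivity (c * Theta ^+ 2 + 5 * (a * b * c)); first by rewrite square; ring.
by rewrite five mul0r addr0 /c -exprD.
Qed.

(** * The congruence *)

(** A nonzero term of Jacobi's expansion has trig d = 0 or 1 modulo 5: if
    trig d = 3 then d = 3 and 2 d - 1 = 0 modulo 5. *)
Lemma euler_cube_eq0 a n : (a = 1 \/ a = 2)%N ->
  (n %% 5 \notin [:: 0; a])%N -> (euler F a ^+ 3) n = 0.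
Proof.
move=> a12 out; have a0 : (0 < a)%N by lia.
have two : 2 != 0 :> F by [].
apply: (mulfI two); rewrite mulr0 -(@jacobi_support F a n a0) => [|d dn].
  by rewrite !mulr_natl !mulr2n.
apply/eqP; rewrite -(dvdz_pcharf pchar_F).
have := trig_mod5 d; move: out; rewrite -dn !inE => out.
by case: a12 => aE; move: out; rewrite aE; do 2?[case: ifP => ?]; lia.
Qed.

(** An exponent that is 0 or 1 plus one that is 0 or 2 is never 4 modulo 5. *)
Lemma dissect4_euler_cubes : dissect 4 (euler F 1 ^+ 3 * euler F 2 ^+ 3) = 0.
Proof.
apply: funext => n; rewrite /dissect seriesM big1 // => i _.
have := ltn_ord i => lt.
have [in1|out1] := boolP (i %% 5 \in [:: 0; 1])%N; last first.
  by rewrite euler_cube_eq0 ?mul0r //; left.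
rewrite [X in _ * X]euler_cube_eq0 ?mulr0 //; first by right.
by move: in1; rewrite !inE; lia.
Qed.

Lemma euler_frob a : (0 < a)%N -> euler F (5 * a) = euler F a ^+ 5.
Proof.
move=> a0; apply: eqm_eq => N; have a5 : (0 < 5 * a)%N by lia.
apply: (eqm_trans (@euler_trunc F _ _ _ a5 (leqnn N))).
apply: (eqm_trans _ (eqm_sym (eqm_exp 5 (@euler_trunc F _ _ _ a0 (leqnn N))))).
rewrite -rmorphXn /qfact -prodrXl (eq_bigr (fun i : 'I_N => (1 - 'X^a ^+ i.+1) ^+ 5)) // => i _.
rewrite exprDn_pchar ?exprNn_pchar ?pnatE ?pchar_polyF // expr1n -!exprM.
by congr (1 - 'X^_); lia.
Qed.

Theorem theorem1p1 (k : nat) (hk0 : (0 < k)%N) (hk : k = 12 %[mod 25])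
    (n : nat) :
  (broken_diamond k (25 * n + 24)%N = 0 %[mod 5])%Z.
Proof.
have [m [m0 kE]] : exists m, (0 < m)%N /\ (2 * k + 1 = 5 * (5 * m))%N.
  by exists ((2 * k + 1) %/ 25)%N; lia.
move: (broken_diamond k) ((broken_diamondP k _).2 (frefl _)) => delta.
rewrite kE !(mulnCA 2) => /funext /(congr1 (reduce F)).
have fps1E : reduce F fps1 = 1 by apply: funext => -[].
rewrite !reduceM fps1E mulr1 -!/(euler F _) !euler_frob; try lia.
set e := euler F 1; set f := euler F 2; set g := euler F m.
set h := euler F (2 * m); set D := reduce F delta => defD.
suff /eqP : D (25 * n + 24)%N = 0 by rewrite -(dvdz_pcharf pchar_F); lia.
have e0 : e 0%N = 1 by apply: euler0.
have f0 : f 0%N = 1 by apply: euler0.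
have h0 : h 0%N = 1 by apply: euler0; lia.
have thetaE : Theta * e = 2 * f ^+ 2 by apply: gauss.
have five : 5 = 0 :> series F by apply: (pcharf0 pchar_seriesF).
have sixteen : 16 = 1 :> series F.
  by transitivity (1 + 3 * 5 : series F); [ring | rewrite five mulr0 addr0].
(* Up to units, D is Theta^3 divided by a fifth power. *)
have step1 : f ^+ 5 * (h ^+ 5 ^+ 5 * D) = 2 * (g ^+ 5 ^+ 5 * Theta ^+ 3).
  apply: (series_cancel f0).
  transitivity (16 * f ^+ 6 * h ^+ 5 ^+ 5 * D).
    by rewrite sixteen; ring.
  transitivity (2 * (2 * f ^+ 2) ^+ 3 * h ^+ 5 ^+ 5 * D); first by ring.
  rewrite -thetaE.
  transitivity (2 * Theta ^+ 3 * (e ^+ 3 * h ^+ 5 ^+ 5 * D)); first by ring.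
  by rewrite defD; ring.
pose V := dissect 4 D.
have step2 : f * (h ^+ 5 * V) = 2 * (g ^+ 5 * Theta ^+ 7).
  rewrite -dissect4_theta_cube -[g ^+ 5 * _]dissect_frob //.
  rewrite -[h ^+ 5 * _]dissect_frob // -[f * _]dissect_frob // step1.
  by rewrite !mulr_natl dissectMn.
pose W := dissect 4 V.
(* Theta^7 e^7 = 2^7 f^14 by Gauss's identity, and 2^8 = 1 in F_5. *)
have step3 : (h * e ^+ 2) ^+ 5 * V = (g * f ^+ 2) ^+ 5 * (e ^+ 3 * f ^+ 3).
  apply: (series_cancel f0).
  transitivity (e ^+ 10 * (f * (h ^+ 5 * V))); first by ring.
  rewrite step2; transitivity (2 * g ^+ 5 * (Theta * e) ^+ 7 * e ^+ 3); first by ring.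
  rewrite thetaE; transitivity (16 * 16 * (g ^+ 5 * f ^+ 14 * e ^+ 3)); first by ring.
  by rewrite sixteen; ring.
have : h * e ^+ 2 * W = 0.
  transitivity (dissect 4 ((h * e ^+ 2) ^+ 5 * V)); first by rewrite dissect_frob.
  by rewrite step3 dissect_frob // dissect4_euler_cubes mulr0.
have he0 : (h * e ^+ 2) 0%N = 1 by rewrite seriesM0 seriesX0 h0 e0 expr1n mulr1.
rewrite -[RHS](mulr0 (h * e ^+ 2)) => /(series_cancel he0) W0.
have := congr1 (fun z : series F => z n) W0; rewrite /W /V /dissect => Dn.
by rewrite -[RHS]Dn; congr (D _); lia.
Qed.
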